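(* Let $\mathcal{A}$ be a unital C$^*$-algebra, let $a,b\in G^+$, and let $m=|b^{1/2}a^{1/2}|=(a^{1/2}ba^{1/2})^{1/2}$. Then the set of all solutions $x\in\mathcal{A}$ of the equation $xax=b$ is $$\{\,a^{-1/2}\,m\,\varepsilon\,a^{-1/2}\;:\;\varepsilon\in Q\ \text{ and }\ \varepsilon m=m\varepsilon\,\}.$$
   Context: For a unital C$^*$-algebra $\mathcal{A}$: $G$ is the group of invertible elements of $\mathcal{A}$, $G^+$ is the set of positive invertible elements, and $Q=\{\varepsilon\in G:\varepsilon^2=1\}$ is the space of reflections. For $x\in\mathcal{A}$, $|x|=(x^*x)^{1/2}$. *)

(* Defs.v *)
From HB Require Import structures.
From mathcomp Require Import all_boot all_order all_algebra complex.
From mathcomp Require Import all_classical all_reals topology normedtype.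

Set Implicit Arguments.
Unset Strict Implicit.
Unset Printing Implicit Defensive.

Import Order.TTheory GRing.Theory Num.Theory.

Local Open Scope classical_set_scope.
Local Open Scope ring_scope.
Local Open Scope complex_scope.

(* Unital C*-algebras over the complex field R[i].  The multiplication is part
   of the mixin because ring structures cannot be joined with normed modules in
   the existing hierarchy; a PzRing instance on the carrier is derived right
   after, so that the notations 1, * and ^+ are available.  It is not an NzRing:
   the zero algebra is a unital C*-algebra, and this is why invertibility is
   not taken from unitRingType below. *)
HB.mixin Record isCStarAlgebra (R : realType) A
    of CompleteNormedModule R[i] A := {
  cstar_one : A ;
  cstar_mul : A -> A -> A ;
  cstar_mulA : associative cstar_mul ;
  cstar_mul1x : left_id cstar_one cstar_mul ;
  cstar_mulx1 : right_id cstar_one cstar_mul ;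
  cstar_mulDl : left_distributive cstar_mul +%R ;
  cstar_mulDr : right_distributive cstar_mul +%R ;
  cstar_scaleAl : forall (l : R[i]) (x y : A),
    l *: cstar_mul x y = cstar_mul (l *: x) y ;
  cstar_scaleAr : forall (l : R[i]) (x y : A),
    l *: cstar_mul x y = cstar_mul x (l *: y) ;
  cstar_normM_le : forall x y : A, `|cstar_mul x y| <= `|x| * `|y| :> R[i] ;
  star : A -> A ;
  starK : involutive star ;
  starD : {morph star : x y / x + y} ;
  starZ : forall (l : R[i]) (x : A), star (l *: x) = l^* *: star x ;
  starM : forall x y : A, star (cstar_mul x y) = cstar_mul (star y) (star x) ;
  cstar_norm : forall x : A, `|cstar_mul (star x) x| = `|x| ^+ 2 :> R[i]
}.

#[short(type="cstarAlgType")]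
HB.structure Definition CStarAlgebra (R : realType) :=
  {A of CompleteNormedModule R[i] A & isCStarAlgebra R A}.

HB.instance Definition _ (R : realType) (A : cstarAlgType R) :=
  GRing.Zmodule_isPzRing.Build (CStarAlgebra.sort A)
    (@cstar_mulA R A) (@cstar_mul1x R A) (@cstar_mulx1 R A)
    (@cstar_mulDl R A) (@cstar_mulDr R A).

Section CStarAlgebraNotions.
Variables (R : realType) (A : cstarAlgType R).
Implicit Types x y e : A.

Definition invertible x : Prop := exists y, x * y = 1 /\ y * x = 1.

(* The two-sided inverse, with value 0 when x is not invertible. *)
Definition cinv x : A := xget 0 [set y | x * y = 1 /\ y * x = 1].

Definition spectrum x : set R[i] := [set l | ~ invertible (l *: (1 : A) - x)].

(* In R[i], 0 <= l means that l is real and nonnegative. *)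
Definition positive x : Prop :=
  star x = x /\ spectrum x `<=` [set l : R[i] | 0 <= l].

(* G^+ *)
Definition posinv : set A := [set x | positive x /\ invertible x].

(* The positive square root, with value 0 when x has none. *)
Definition csqrt x : A := xget 0 [set y | positive y /\ y * y = x].

Definition cabs x : A := csqrt (star x * x).

(* Q *)
Definition reflections : set A := [set e | invertible e /\ e ^+ 2 = 1].

End CStarAlgebraNotions.

Arguments posinv {R} A.
Arguments reflections {R} A.

(* Main.v *)
Require Import Defs.
From mathcomp Require Import all_boot all_order all_algebra complex.
From mathcomp Require Import all_classical all_reals topology normedtype.
From mathcomp Require Import sequences lra ring.

Import Order.TTheory GRing.Theory Num.Theory.
Import numFieldNormedType.Exports.

Local Open Scope classical_set_scope.
Local Open Scope ring_scope.

(** The substitution y = a^(1/2) x a^(1/2) turns x a x = b into y * y = c, where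
c = a^(1/2) b a^(1/2).  Since m * m = c, a solution y commutes with m * m.  A
strictly positive m has the same commutant as its square, hence y commutes with
m, and then e = m^-1 y is a reflection commuting with m; conversely y = m e
squares to m * m for every such e.  This is the whole algebra of the theorem;
the analytic content is that the square roots exist, that c and m are positive
and invertible, and the statement on commutants.

Spectral positivity is awkward for all this, so the development rests on a
metric version: x is strictly positive ([spos]) when it is self-adjoint and lies
within distance < t of the scalar t, for some t > 0.  In this form x is
t (1 - w) with |w| < 1 ([spos_contraction]), so that sums are immediate,
invertibility is the Neumann series, square roots come from the fixed point of
v |-> (w + v^2) / 2 ([spos_sqrt]), and m d = - d m forces d = 0 because it reads
2 d = d w + w d ([commute_of_commute_sq]).

The bridge is [posinv_spos] and [spos_posinv]: x is positive and invertible in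
the spectral sense iff it is strictly positive.  The hard half, [posinv_spos],
avoids the spectral radius formula and the functional calculus. Consider the c
>= 0 such that x + c is strictly positive: there are large ones, the condition
is open ([spos_open]), and it is closed wherever x + c is invertible
([spos_limit]). As x + c is invertible for all c >= 0, the infimum of these c
must be 0 and must be attained ([spos_of_invertibleD]). Closedness uses that u
* u + e is strictly positive for self-adjoint u and e > 0 ([spos_sqD]), which
comes from the unitary u + i (1 - u^2)^(1/2) when |u| < 1 ([nrm_1Bsq_le1]).
Finally c is positive by the same criterion, because a^(1/2) b a^(1/2) + r
factors through b + r a^-1 ([spos_congruence]). *)

Section CStarTheory.
Context {R : realType} {A : cstarAlgType R}.
Implicit Types (x y z u v w : A) (s t c : R) (l : R[i]).

(** * Real norm and scalars *)

(** Taken in R rather than R[i], where the order is only partial. *)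
Definition nrm x : R := complex.Re `|x|.

Lemma normE x : `|x| = (nrm x)%:C%C.
Proof. by rewrite /nrm RRe_real// ger0_real. Qed.

Lemma nrm_ge0 x : 0 <= nrm x.
Proof. by rewrite -lecR -normE normr_ge0. Qed.

Lemma nrmD x y : nrm (x + y) <= nrm x + nrm y.
Proof. by rewrite -lecR rmorphD/= -!normE ler_normD. Qed.

Lemma nrmN x : nrm (- x) = nrm x.
Proof. by rewrite /nrm normrN. Qed.

Lemma nrmBC x y : nrm (x - y) = nrm (y - x).
Proof. by rewrite -nrmN opprB. Qed.

Lemma nrm0 : nrm (0 : A) = 0.
Proof. by rewrite /nrm normr0. Qed.

Lemma nrm0_eq0 x : nrm x <= 0 -> x = 0.
Proof.
move=> x0; apply/normr0_eq0; rewrite normE.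
by have -> : nrm x = 0 by apply/eqP; rewrite eq_le x0 nrm_ge0.
Qed.

Lemma nrmM x y : nrm (x * y) <= nrm x * nrm y.
Proof.
rewrite -lecR rmorphM/= -!normE; exact: cstar_normM_le.
Qed.

Lemma nrmZ l x : nrm (l *: x) = complex.Re `|l| * nrm x.
Proof.
have E : `|l| = (complex.Re `|l|)%:C%C by rewrite RRe_real// ger0_real.
by rewrite {1}/nrm normrZ normE E -rmorphM.
Qed.

Lemma nrm_cstar x : nrm (star x * x) = nrm x ^+ 2.
Proof.
have := cstar_norm x; rewrite -/(star x * x) !normE -rmorphXn.
by move/complexI.
Qed.

(** The C*-identity gives |x|^2 <= |x*| |x|; the involution gives the converse. *)
Lemma nrm_star x : nrm (star x) = nrm x.
Proof.
suff H y : nrm y <= nrm (star y).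
  by apply/eqP; rewrite eq_le H -{2}(starK x) H.
have [y0|y0] := lerP (nrm y) 0; first exact: le_trans y0 (nrm_ge0 _).
by rewrite -(ler_pM2r y0) -expr2 -nrm_cstar nrmM.
Qed.

Lemma star_mul x y : star (x * y) = star y * star x.
Proof. exact: starM. Qed.

Lemma star1 : star (1 : A) = 1.
Proof. by rewrite -[LHS]mulr1 -{2}(starK 1) -star_mul mulr1 starK. Qed.

Lemma star0 : star (0 : A) = 0.
Proof. by apply: (@addrI _ (star 0)); rewrite -starD !addr0. Qed.

Lemma starN x : star (- x) = - star x.
Proof. by apply/eqP; rewrite -subr_eq0 opprK -starD addNr star0. Qed.

Lemma nrm1 : nrm (1 : A) <= 1.
Proof.
have := nrm_cstar 1; rewrite star1 mulr1 => E.
have [//|lt1] := lerP; have := nrm_ge0 (1 : A); nra.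
Qed.

(** The real scalars are central elements of the algebra rather than operators on
it, so that in ring identities they are moved by [scC] alone. *)
Definition sc c : A := (c%:C)%C *: (1 : A).

Lemma scaleAl l x y : l *: (x * y) = (l *: x) * y.
Proof. exact: cstar_scaleAl. Qed.

Lemma scaleAr l x y : l *: (x * y) = x * (l *: y).
Proof. exact: cstar_scaleAr. Qed.

Lemma scE c x : sc c * x = (c%:C)%C *: x.
Proof. by rewrite /sc -scaleAl mul1r. Qed.

Lemma scC c x : x * sc c = sc c * x.
Proof. by rewrite scE /sc -scaleAr mulr1. Qed.

Lemma scD s t : sc (s + t) = sc s + sc t.
Proof. by rewrite /sc rmorphD scalerDl. Qed.

Lemma scN s : sc (- s) = - sc s.
Proof. by rewrite /sc rmorphN scaleNr. Qed.

Lemma scM s t : sc (s * t) = sc s * sc t.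
Proof. by rewrite scE /sc scalerA rmorphM. Qed.

Lemma sc0 : sc 0 = 0.
Proof. by rewrite /sc scale0r. Qed.

Lemma sc1 : sc 1 = 1.
Proof. by rewrite /sc scale1r. Qed.

Lemma star_sc c : star (sc c) = sc c.
Proof. by rewrite /sc starZ star1 conj_Creal ?complex_real. Qed.

Lemma nrm_sc c x : nrm (sc c * x) = `|c| * nrm x.
Proof. by rewrite scE nrmZ normc_def/= expr0n addr0 sqrtr_sqr. Qed.

Lemma nrm_sc_le c : nrm (sc c) <= `|c|.
Proof.
by rewrite -[sc c]mulr1 nrm_sc ler_piMr// nrm1.
Qed.

(** * Completeness *)

Lemma nrm_complete (a : nat -> A) :
  (forall e : R, 0 < e -> exists N, forall n m, (N <= n)%N -> (N <= m)%N ->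
     nrm (a n - a m) < e) ->
  exists p, forall e : R, 0 < e -> exists N, forall n, (N <= n)%N ->
     nrm (p - a n) < e.
Proof.
move=> H.
have /cauchy_cvgP ac : cauchy (a n @[n --> \oo]).
  apply: cauchy_exP => e e0.
  have eE : e = (complex.Re e)%:C%C by rewrite RRe_real// gtr0_real.
  have [N HN] : exists N, forall n m, (N <= n)%N -> (N <= m)%N ->
      nrm (a n - a m) < complex.Re e by apply: H; rewrite -ltcR -eE.
  exists (a N); exists N => // n /= Nn.
  by rewrite -ball_normE /ball_/= normE eE ltcR HN.
exists (lim (a n @[n --> \oo])) => e e0.
have /cvgrPdist_lt/(_ (e%:C)%C) := ac.
rewrite ltcR => /(_ e0) [N _ HN].
by exists N => n Nn; have := HN n Nn; rewrite /= normE ltcR.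
Qed.

(** Banach's theorem on a ball centred at 0.  The iterates of 0 are Cauchy since
|f^(m+n) 0 - f^n 0| <= q^n |f^m 0| <= q^n r. *)
Lemma fixpoint_contraction (f : A -> A) (q r : R) :
  0 <= q -> q < 1 -> 0 <= r ->
  (forall x, nrm x <= r -> nrm (f x) <= r) ->
  (forall x y, nrm x <= r -> nrm y <= r -> nrm (f x - f y) <= q * nrm (x - y)) ->
  exists2 p, nrm p <= r & p = f p.
Proof.
move=> q0 q1 r0 fr fq; pose a n := iter n f 0.
have ar n : nrm (a n) <= r by elim: n => [|n IH]; rewrite ?nrm0//=; exact: fr.
have aq n m : nrm (a (m + n)%N - a n) <= q ^+ n * r.
  elim: n => [|n IH]; first by rewrite addn0 subr0 expr0 mul1r.
  rewrite addnS/= exprS -mulrA; apply: le_trans (fq _ _ (ar _) (ar _)) _.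
  exact: ler_wpM2l.
have [|p Hp] := nrm_complete a.
  move=> e e0.
  have : (q ^+ n * (2 * r + 1)) @[n --> \oo] --> (0 * (2 * r + 1)).
    apply: cvgMl; apply: cvg_expr; by rewrite ger0_norm.
  rewrite mul0r => /cvgrPdist_lt/(_ _ e0)[N _ /(_ N (leqnn N))/=].
  rewrite sub0r normrN ger0_norm; last by rewrite mulr_ge0// ?exprn_ge0//; lra.
  move=> Ne; exists N => n m /subnK <- /subnK <-.
  set j := (n - N)%N; set k := (m - N)%N.
  have -> : a (j + N)%N - a (k + N)%N =
            (a (j + N)%N - a N) - (a (k + N)%N - a N).
    by rewrite opprB addrA subrK.
  have := nrmD (a (j + N)%N - a N) (- (a (k + N)%N - a N)).
  have := aq N j; have := aq N k; rewrite nrmN.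
  have : 0 <= q ^+ N by rewrite exprn_ge0.
  nra.
have pr : nrm p <= r.
  apply/ler_addgt0Pr => e e0; have [N /(_ N (leqnn N)) HN] := Hp e e0.
  rewrite -(subrK (a N) p) (le_trans (nrmD _ _))// addrC lerD ?ar//; exact: ltW.
exists p => //; apply/eqP; rewrite -subr_eq0; apply/eqP/nrm0_eq0.
apply/ler_addgt0Pr => e e0; rewrite add0r.
have /Hp[N HN] : 0 < e / 2 by rewrite divr_gt0.
have -> : p - f p = (p - a N.+1) + (f (a N) - f p) by rewrite /= addrA subrK.
have := nrmD (p - a N.+1) (f (a N) - f p).
have := HN N.+1 (leqnSn N); have := HN N (leqnn N).
have := fq _ _ (ar N) pr; have := nrm_ge0 (a N - p).
rewrite [nrm (p - a N)]nrmBC; nra.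
Qed.

(** * Invertibility *)

(** The one-sided inverses are the fixed points of w |-> 1 + y w and
w |-> 1 + w y, which replaces the Neumann series.  Both maps preserve the ball
of radius 1 / (1 - |y|). *)
Lemma invertible1B y : nrm y < 1 -> invertible (1 - y).
Proof.
move=> y1; have y0 := nrm_ge0 y; pose r := (1 - nrm y)^-1.
have d0 : 0 < 1 - nrm y by lra.
have r0 : 0 <= r by rewrite invr_ge0 ltW.
have rE : 1 + nrm y * r = r by rewrite /r; field; rewrite gt_eqF.
have [|w w' _ _|z _ Ez] := @fixpoint_contraction (fun w => 1 + y * w) _ _ y0 y1 r0.
- move=> w wr; rewrite (le_trans (nrmD _ _))// -rE lerD ?nrm1//.
  by rewrite (le_trans (nrmM _ _))// ler_wpM2l.
- by rewrite opprD addrACA subrr add0r -mulrBr nrmM.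
have [|w w' _ _|z' _ Ez'] := @fixpoint_contraction (fun w => 1 + w * y) _ _ y0 y1 r0.
- move=> w wr; rewrite (le_trans (nrmD _ _))// -rE lerD ?nrm1//.
  by rewrite (le_trans (nrmM _ _))// mulrC ler_wpM2l.
- by rewrite opprD addrACA subrr add0r -mulrBl mulrC nrmM.
have zr : (1 - y) * z = 1 by rewrite mulrBl mul1r {1}Ez addrK.
have zl : z' * (1 - y) = 1 by rewrite mulrBr mulr1 {1}Ez' addrK.
suff E : z' = z by exists z; split=> //; rewrite -E.
by rewrite -[z]mul1r -zl -mulrA zr mulr1.
Qed.

Lemma invertibleZ l x : l != 0 -> invertible x -> invertible (l *: x).
Proof.
move=> l0 [y [xy yx]]; exists (l^-1 *: y).
by rewrite -!scaleAl -!scaleAr xy yx !scalerA mulfV// mulVf// !scale1r.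
Qed.

Lemma invertibleM x y : invertible x -> invertible y -> invertible (x * y).
Proof.
move=> [x' [xx' x'x]] [y' [yy' y'y]]; exists (y' * x'); split.
  by rewrite mulrA -(mulrA x) yy' mulr1.
by rewrite mulrA -(mulrA y') x'x mulr1.
Qed.

Lemma invertible_scaleB l x : nrm x < complex.Re `|l| -> invertible (l *: (1 : A) - x).
Proof.
move=> xl; have lE : `|l| = (complex.Re `|l|)%:C%C by rewrite RRe_real// ger0_real.
have l0 : l != 0.
  apply/eqP => l0; move: xl; rewrite l0 normr0 /=.
  by have := nrm_ge0 x; lra.
have -> : l *: (1 : A) - x = l *: (1 - l^-1 *: x).
  by rewrite scalerBr scalerA mulfV// scale1r.
apply: invertibleZ => //; apply: invertible1B.
rewrite nrmZ normfV lE -fmorphV/= mulrC ltr_pdivrMr ?mul1r//.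
by apply: le_lt_trans xl; exact: nrm_ge0.
Qed.

(** A self-adjoint element has real spectrum.  With l = s + i t and g = x - s, the
C*-identity gives |g + i mu|^2 <= |g|^2 + mu^2, which is smaller than
(t + mu)^2 for a suitable real mu; then l - x = i (t + mu) - (g + i mu) is
invertible. *)
Lemma invertible_selfadjoint_scaleB x l :
  star x = x -> complex.Im l != 0 -> invertible (l *: (1 : A) - x).
Proof.
move=> sx; case: l => [s t] /= t0.
(* The name g is opaque, since rewriting would otherwise unify through its sum;
   mu is chosen so that 2 t mu = |g|^2, and (t + mu)^2 = t^2 + |g|^2 + mu^2. *)
have [g gE] : exists g, g = x - sc s by exists (x - sc s).
pose mu := nrm g ^+ 2 / (2 * t).
have sg : star g = g by rewrite gE starD starN sx star_sc.
pose i := 'i%C : R[i].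
have ii : i * i = -1 by rewrite -expr2 sqr_i.
have si y : star (i *: y) = - (i *: star y).
  by rewrite starZ -scaleNr; congr (_ *: _); rewrite /i; simpc.
pose h := g + i *: sc mu.
have hE : star h * h = g * g + sc mu * sc mu.
  have e1 : g * (i *: sc mu) = i *: (sc mu * g) by rewrite -scaleAr scC.
  have e2 : (i *: sc mu) * g = i *: (sc mu * g) by rewrite -scaleAl.
  have e3 : (i *: sc mu) * (i *: sc mu) = - (sc mu * sc mu).
    by rewrite -scaleAl -scaleAr scalerA ii scaleN1r.
  rewrite /h starD si sg star_sc mulrDl !mulrDr !mulNr e1 e2 e3 opprK.
  by rewrite addrA addrK.
have hn : nrm h ^+ 2 <= nrm g ^+ 2 + mu ^+ 2.
  rewrite -nrm_cstar hE (le_trans (nrmD _ _))// lerD//.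
    by rewrite expr2 nrmM.
  by rewrite nrm_sc -[leRHS]real_normK ?num_real// expr2 ler_wpM2l// nrm_sc_le.
have -> : (s +i* t)%C *: (1 : A) - x = (i * (t + mu)%:C%C) *: (1 : A) - h.
  rewrite rmorphD mulrDr scalerDl [(s +i* t)%C]complexE/= scalerDl /h gE.
  rewrite -!scalerA -/(sc _) -/(sc s) -/(sc mu) -/(sc t).
  by rewrite opprD addrACA subrr addr0 opprB addrCA addrA.
apply: invertible_scaleB.
have -> : complex.Re `|i * ((t + mu)%:C)%C| = `|t + mu|.
  rewrite normrM !normc_def /= !expr0n /= expr1n add0r addr0 sqrtr1 sqrtr_sqr.
  by rewrite mul1r mul0r subr0.
rewrite -(@ltr_pXn2r _ 2)// ?nnegrE ?nrm_ge0// real_normK ?num_real//.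
have E : 2 * t * mu = nrm g ^+ 2 by rewrite /mu; field.
have : 0 < t ^+ 2 by rewrite exprn_even_gt0.
by rewrite sqrrD -mulrnAl -mulr_natl E; lra.
Qed.

(** * Strict positivity *)

(** Existence of one t suffices: the condition persists for all larger t. *)
Definition spos x := star x = x /\ exists2 t, 0 < t & nrm (sc t - x) < t.

Lemma star_scM c x : star (sc c * x) = sc c * star x.
Proof. by rewrite star_mul star_sc scC. Qed.

Lemma scMV t : t != 0 -> sc t * sc t^-1 = 1.
Proof. by move=> t0; rewrite -scM mulfV// sc1. Qed.

Lemma spos_contraction x :
  spos x <-> exists t w, [/\ 0 < t, nrm w < 1, star w = w & x = sc t * (1 - w)].
Proof.
split=> [[sx [t t0 xt]]|[t [w [t0 w1 sw ->]]]].
- have ti0 : 0 < t^-1 by rewrite invr_gt0.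
  exists t, (sc t^-1 * (sc t - x)); split=> //.
  + by rewrite nrm_sc gtr0_norm// mulrC ltr_pdivrMr// mul1r.
  + by rewrite star_scM starD starN star_sc sx.
  + by rewrite mulrBr mulr1 mulrA scMV ?gt_eqF// mul1r opprB addrC subrK.
- split; first by rewrite star_scM starD starN star1 sw.
  exists t => //; rewrite mulrBr mulr1 opprB addrC subrK nrm_sc gtr0_norm//.
  by rewrite gtr_pMr.
Qed.

Lemma spos_invertible x : spos x -> invertible x.
Proof.
move=> /spos_contraction[t [w [t0 w1 _ ->]]]; rewrite scE.
apply: invertibleZ; last exact: invertible1B.
by apply/eqP => /(congr1 (@complex.Re R))/= t00; rewrite t00 ltxx in t0.
Qed.

Lemma sposD x y : spos x -> spos y -> spos (x + y).
Proof.
move=> [sx [s s0 xs]] [sy [t t0 yt]]; split; first by rewrite starD sx sy.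
exists (s + t); first exact: addr_gt0.
by rewrite scD opprD addrACA (le_lt_trans (nrmD _ _))// ltrD.
Qed.

Lemma spos_sc c : 0 < c -> spos (sc c).
Proof.
by move=> c0; split; [exact: star_sc | exists c; rewrite // subrr nrm0].
Qed.

Lemma sposZ c x : 0 < c -> spos x -> spos (sc c * x).
Proof.
move=> c0 [sx [t t0 xt]]; split; first by rewrite star_scM sx.
exists (c * t); first exact: mulr_gt0.
by rewrite scM -mulrBr nrm_sc gtr0_norm// ltr_pM2l.
Qed.

(** The spectrum is real, and x - l is a sum of strictly positive elements when
l < 0. *)
Lemma spos_posinv x : spos x -> posinv A x.
Proof.
move=> px; have [sx _] := px; split; last exact: spos_invertible.
split=> // l lx; have [l0|l0] := eqVneq (complex.Im l) 0; last first.
  by case: lx; exact: invertible_selfadjoint_scaleB.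
have lE : l = (complex.Re l)%:C%C.
  by rewrite [LHS]complexE l0 mulr0 addr0.
rewrite /= lE lecR leNgt; apply/negP => ln.
apply: lx; rewrite lE -/(sc _) -[sc _]opprK -scN -opprD -scaleN1r.
apply: invertibleZ; first by rewrite oppr_eq0 oner_eq0.
apply: spos_invertible; apply: sposD => //; apply: spos_sc; lra.
Qed.

(** With x = t (1 - w), a root t^(1/2) (1 - p) amounts to p = (w + p^2) / 2, a
contraction of the ball of radius |w|.  Its fixed point is self-adjoint by
uniqueness. *)
Lemma spos_sqrt x : spos x -> exists2 v, spos v & v * v = x.
Proof.
move=> /spos_contraction[t [w [t0 w1 sw ->]]].
have q0 := nrm_ge0 w; pose f v := sc 2^-1 * (w + v * v).
have h2 : `|2^-1 : R| = 2^-1 by rewrite gtr0_norm// invr_gt0.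
have fq v v' : nrm v <= nrm w -> nrm v' <= nrm w ->
    nrm (f v - f v') <= nrm w * nrm (v - v').
  move=> vq vq'; rewrite /f -mulrBr nrm_sc h2 opprD addrACA subrr add0r.
  have -> : v * v - v' * v' = v * (v - v') + (v - v') * v'.
    by rewrite mulrBr mulrBl addrA subrK.
  have := nrmD (v * (v - v')) ((v - v') * v').
  have := nrmM v (v - v'); have := nrmM (v - v') v'.
  have := nrm_ge0 (v - v'); nra.
have [|p pq Ep] := @fixpoint_contraction f _ _ q0 w1 q0 _ fq.
  move=> v vq; rewrite /f nrm_sc h2.
  have := nrmD w (v * v); have := nrmM v v; have := nrm_ge0 v; nra.
have sp : star p = p.
  have Ep' : star p = f (star p).
    by rewrite {1}Ep /f star_scM starD star_mul sw.
  apply/eqP; rewrite -subr_eq0; apply/eqP/nrm0_eq0.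
  have := fq (star p) p; rewrite -Ep -Ep' nrm_star => /(_ pq pq).
  have := nrm_ge0 (star p - p); nra.
have pp : p * p = p + p - w.
  have : sc 2 * p = w + p * p.
    by rewrite {1}Ep /f mulrA scMV ?pnatr_eq0// mul1r.
  by rewrite (_ : 2 = 1 + 1)// scD sc1 mulrDl mul1r => ->; rewrite addrC addKr.
exists (sc (Num.sqrt t) * (1 - p)).
  apply/spos_contraction; exists (Num.sqrt t), p; split=> //.
    by rewrite sqrtr_gt0.
  exact: le_lt_trans w1.
rewrite mulrA -(mulrA (sc _) (1 - p)) scC !mulrA -scM -expr2 sqr_sqrtr ?ltW//.
rewrite -mulrA; congr (_ * _).
by rewrite mulrBr mulr1 mulrBl mul1r pp opprB (addrAC _ (- w)) addrK addrA subrK.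
Qed.

(** The commutator d = m y - y m anticommutes with m.  Writing m = t (1 - w) this
becomes 2 d = d w + w d, so |d| <= |w| |d| with |w| < 1. *)
Lemma commute_of_commute_sq m y :
  spos m -> y * (m * m) = m * m * y -> y * m = m * y.
Proof.
move=> /spos_contraction[t [w [t0 w1 _ mE]]] ym.
have [d dE] : exists d, d = m * y - y * m by exists (m * y - y * m).
have dm : d * m = - (m * d).
  by rewrite dE mulrBl mulrBr -!mulrA ym opprB !mulrA.
have dw : d + d = d * w + w * d.
  have E : sc t * (d - d * w) = sc t * (w * d - d).
    move: dm; rewrite mE mulrA scC -!mulrA -mulrN mulrBr mulr1 mulrBl mul1r.
    by rewrite opprB.
  have /(congr1 (fun z => sc t^-1 * z)) := E.
  rewrite !mulrA -!scM mulVf ?gt_eqF// sc1 !mul1r => /eqP.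
  by rewrite subr_eq addrAC eq_sym subr_eq addrC eq_sym => /eqP.
have d0 : d = 0.
  apply: nrm0_eq0.
  have : nrm (d + d) <= nrm w * nrm d + nrm w * nrm d.
    rewrite dw (le_trans (nrmD _ _))// lerD//; last exact: nrmM.
    by rewrite mulrC nrmM.
  have -> : d + d = sc 2 * d by rewrite (_ : 2 = 1 + 1)// scD sc1 mulrDl mul1r.
  rewrite nrm_sc gtr0_norm//; have := nrm_ge0 d; nra.
by apply/eqP; rewrite eq_sym -subr_eq0 -dE d0.
Qed.

(** The roots p of 1 + u and q of 1 - u commute, so r = p q is self-adjoint with
r^2 = 1 - u^2.  Then u + i r is unitary, and r, its imaginary part, has norm at
most 1. *)
Lemma nrm_1Bsq_le1 u : star u = u -> nrm u < 1 -> nrm (1 - u * u) <= 1.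
Proof.
move=> su u1.
have [p pp pE] : exists2 p, spos p & p * p = 1 + u.
  apply: spos_sqrt; apply/spos_contraction; exists 1, (- u).
  by rewrite sc1 mul1r opprK nrmN starN su.
have [q pq qE] : exists2 q, spos q & q * q = 1 - u.
  by apply: spos_sqrt; apply/spos_contraction; exists 1, u; rewrite sc1 mul1r.
have uE : u = p * p - 1 by rewrite pE addrC addKr.
have up : u * p = p * u by rewrite uE mulrBl mulrBr mulr1 mul1r mulrA.
have pqC : p * q = q * p.
  by apply: commute_of_commute_sq => //; rewrite qE mulrBl mulrBr mulr1 mul1r up.
have uq : u * q = q * u.
  have -> : u = 1 - q * q by rewrite qE opprB addrC subrK.
  by rewrite mulrBl mulrBr mulr1 mul1r mulrA.
have [r rE] : exists r, r = p * q by exists (p * q).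
have rr : r * r = 1 - u * u.
  rewrite rE mulrA -(mulrA p q p) -pqC mulrA pE -mulrA qE.
  by rewrite mulrDl mul1r mulrBr mulr1 addrA subrK.
have sr : star r = r by rewrite rE star_mul pp.1 pq.1.
have ur : u * r = r * u by rewrite rE mulrA up -mulrA uq mulrA.
have [i iE] : exists i : R[i], i = 'i%C by exists 'i%C.
have ii : i * i = -1 by rewrite iE -expr2 sqr_i.
pose U := u + i *: r.
have sU : star U = u - i *: r.
  by rewrite starD su starZ sr -scaleNr; congr (_ + _ *: _); rewrite iE; simpc.
have UU : star U * U = 1.
  have e1 : u * (i *: r) = i *: (r * u) by rewrite -scaleAr ur.
  have e2 : (i *: r) * u = i *: (r * u) by rewrite -scaleAl.
  have e3 : (i *: r) * (i *: r) = - (r * r).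
    by rewrite -scaleAl -scaleAr scalerA ii scaleN1r.
  rewrite sU mulrDl !mulrDr !mulNr e1 e2 e3 opprK.
  by rewrite addrA addrK rr addrC subrK.
have U1 : nrm U <= 1.
  have := nrm_cstar U; rewrite UU => E; have := nrm1; have := nrm_ge0 U; nra.
have r1 : nrm r <= 1.
  have E : i *: (sc 2 * r) = U - star U.
    rewrite sU /U opprB [RHS]addrC addrA subrK (_ : 2 = 1 + 1)// scD sc1 mulrDl mul1r.
    by rewrite scalerDr.
  have := nrmD U (- star U); rewrite -E nrmN nrm_star nrmZ nrm_sc.
  by rewrite iE normc_def /= expr0n expr1n add0r sqrtr1 gtr0_norm//; lra.
rewrite -rr; have := nrmM r r; have := nrm_ge0 r; nra.
Qed.

(** By rescaling u to v = u / T of norm < 1, the distance from u^2 + e to T^2 + e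
is T^2 |1 - v^2| <= T^2. *)
Lemma spos_sqD u e : star u = u -> 0 < e -> spos (u * u + sc e).
Proof.
move=> su e0; split; first by rewrite starD star_mul su star_sc.
pose T := nrm u + 1; have T0 : 0 < T by rewrite ltr_wpDl// nrm_ge0.
have Ti : 0 < T^-1 by rewrite invr_gt0.
have [v vE] : exists v, v = sc T^-1 * u by exists (sc T^-1 * u).
have uE : u = sc T * v by rewrite vE mulrA scMV ?gt_eqF// mul1r.
exists (T * T + e); first by rewrite addr_gt0// mulr_gt0.
have v1 : nrm v < 1.
  by rewrite vE nrm_sc gtr0_norm// mulrC ltr_pdivrMr// mul1r ltrDl.
have sv : star v = v by rewrite vE star_scM su.
have vv := nrm_1Bsq_le1 _ sv v1.
have -> : sc (T * T + e) - (u * u + sc e) = sc (T * T) * (1 - v * v).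
  rewrite scD opprD addrACA subrr addr0 mulrBr mulr1; congr (_ - _).
  by rewrite scM {1}uE -!mulrA; congr (_ * _); rewrite uE mulrA scC -mulrA.
rewrite nrm_sc gtr0_norm ?mulr_gt0//.
have : 0 < T * T by rewrite mulr_gt0.
nra.
Qed.

(** * Spectral and strict positivity *)

Lemma spos_open x : spos x ->
  exists2 e, 0 < e & forall d, 0 <= d -> d <= e -> spos (x - sc d).
Proof.
move=> [sx [t t0 xt]]; exists ((t - nrm (sc t - x)) / 2).
  by rewrite divr_gt0// subr_gt0.
move=> d d0 de; split; first by rewrite starD starN star_sc sx.
exists t => //; rewrite opprB addrCA (le_lt_trans (nrmD _ _))//.
by have := nrm_sc_le d; rewrite ger0_norm//; lra.
Qed.

(** Let z be the inverse of x + e.  It is bounded by some K independently of small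
e, hence K - z is strictly positive, with root w; if v is the root of x + e,
then v w is self-adjoint and (v w)^2 = K (x + e) - 1.  By [spos_sqD] x + e
exceeds a positive constant that depends only on K, and e can be chosen equal
to that constant. *)
Lemma spos_limit x : star x = x -> invertible x ->
  (forall e, 0 < e -> spos (x + sc e)) -> spos x.
Proof.
move=> sx [y [xy yx]] px; have y0 := nrm_ge0 y.
pose K := 2 * nrm y + 1; have K0 : 0 < K by rewrite /K; lra.
(* K bounds the inverse of x + e strictly, and K e = 1/2 makes the two errors
   below cancel: K (x + e) - 1 + 1/2 = K x. *)
pose e := (2 * K)^-1; have e0 : 0 < e by rewrite invr_gt0; lra.
have Ke : K * e = 2^-1 by rewrite /e; field; rewrite gt_eqF.
have := px _ e0; set xe := x + sc e => pxe.
have [z [xz zx]] := spos_invertible _ pxe.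
have sxe := pxe.1.
have sz : star z = z.
  have h : star z * xe = 1 by rewrite -{1}sxe -star_mul xz star1.
  by rewrite -[star z]mulr1 -xz mulrA h mul1r.
have zK : nrm z < K.
  have zE : z = y - sc e * (y * z).
    have : y * xe * z = y by rewrite -mulrA xz mulr1.
    rewrite mulrDr yx mulrDl mul1r scC -mulrA => E.
    by rewrite -{1}E addrK.
  have : nrm z <= nrm y + e * (nrm y * nrm z).
    rewrite {1}zE (le_trans (nrmD _ _))// nrmN nrm_sc gtr0_norm// lerD2l.
    by rewrite ler_pM2l// nrmM.
  have : e * nrm y <= 2^-1 by rewrite -Ke mulrC ler_pM2r// /K; lra.
  have := nrm_ge0 z; rewrite /K mulrA; nra.
have [w pw wE] : exists2 w, spos w & w * w = sc K - z.
  apply: spos_sqrt; split; first by rewrite starD starN star_sc sz.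
  by exists K; rewrite // opprB addrC subrK.
have [v pv vE] := spos_sqrt _ pxe.
have zv : z * v = v * z.
  by apply: commute_of_commute_sq => //; rewrite vE xz zx.
have wv : v * w = w * v.
  by apply: commute_of_commute_sq => //; rewrite wE mulrBr mulrBl scC zv.
have E : (v * w) * (v * w) = sc K * xe - 1.
  rewrite {2}wv mulrA -(mulrA v w w) wE mulrBr -zv mulrBl scC -!mulrA vE.
  by rewrite zx.
have : spos ((v * w) * (v * w) + sc 2^-1).
  by apply: spos_sqD; rewrite ?invr_gt0// star_mul pv.1 pw.1.
have -> : (v * w) * (v * w) + sc 2^-1 = sc K * x.
  rewrite E /xe mulrDr -scM Ke.
  have : sc 1 = sc 2^-1 + sc 2^-1 by rewrite -scD; congr sc; field.
  by rewrite sc1 => ->; rewrite opprD addrA addrK subrK.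
move=> /(@sposZ K^-1 _ _); rewrite mulrA -scM mulVf ?gt_eqF// sc1 mul1r.
by apply; rewrite invr_gt0.
Qed.

(** The infimum of the c >= 0 with x + c strictly positive belongs to this set by
[spos_limit], and cannot be positive by [spos_open]. *)
Lemma spos_of_invertibleD x : star x = x ->
  (forall c, 0 <= c -> invertible (x + sc c)) -> spos x.
Proof.
move=> sx ix.
have sxc c : star (x + sc c) = x + sc c by rewrite starD star_sc sx.
pose S := [set c : R | 0 <= c /\ spos (x + sc c)].
have Slb : lbound S 0 by move=> c [].
have Sinf : has_inf S.
  split; last by exists 0.
  exists (nrm x + 1); split; first by have := nrm_ge0 x; lra.
  split; first exact: sxc.
  exists (nrm x + 1); first by have := nrm_ge0 x; lra.
  by rewrite opprD addrCA subrr addr0 nrmN ltrDl.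
have i0 : 0 <= inf S by apply: lb_le_inf => //; case: Sinf.
have pinf : spos (x + sc (inf S)).
  apply: spos_limit => //; first exact: ix.
  move=> e e0; have [c [c0 pc] ce] := inf_adherent e0 Sinf.
  have -> : x + sc (inf S) + sc e = x + sc c + sc (inf S + e - c).
    by rewrite -!addrA -!scD; congr (_ + sc _); ring.
  by apply: sposD => //; apply: spos_sc; lra.
have [E|ne] := eqVneq (inf S) 0; first by rewrite E sc0 addr0 in pinf.
have gt0 : 0 < inf S by rewrite lt_def ne.
have [e e0 pe] := spos_open _ pinf.
pose d := Num.min e (inf S / 2).
have d0 : 0 < d by rewrite lt_min e0 divr_gt0.
have de : d <= e by rewrite ge_min lexx.
have dS : d <= inf S / 2 by rewrite ge_min lexx orbT.
have : inf S <= inf S - d.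
  apply: ge_inf; first by exists 0.
  split; first lra.
  by rewrite scD [sc (- d)]scN addrA; apply: pe => //; exact: ltW.
lra.
Qed.

Lemma posinv_spos x : posinv A x -> spos x.
Proof.
move=> [[sx px] ix]; apply: spos_of_invertibleD => // c c0.
have [->|cn0] := eqVneq c 0; first by rewrite sc0 addr0.
apply: contrapT => nx.
have : spectrum x (- c)%:C%C.
  move=> h; apply: nx.
  have -> : x + sc c = (-1) *: ((- c)%:C%C *: (1 : A) - x).
    by rewrite -/(sc _) scN scaleN1r opprD !opprK addrC.
  by apply: invertibleZ => //; rewrite oppr_eq0 oner_eq0.
move=> /px/=; rewrite lecR oppr_ge0 => c0'.
by case/eqP: cn0; apply/eqP; rewrite eq_le c0 c0'.
Qed.

(** * Square roots and congruences *)

Lemma cinvP x : invertible x -> x * cinv x = 1 /\ cinv x * x = 1.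
Proof. exact: xgetPex. Qed.

(** [csqrt] picks some positive root, a priori not the one of [spos_sqrt].  It is
strictly positive because it is invertible, being a factor of x on both sides. *)
Lemma csqrtP x : posinv A x -> spos (csqrt x) /\ csqrt x * csqrt x = x.
Proof.
move=> px; have [v pv vE] := spos_sqrt _ (posinv_spos _ px).
have [pr rr] : positive (csqrt x) /\ csqrt x * csqrt x = x.
  apply: (@xgetPex _ 0 [set y | positive y /\ y * y = x]).
  by exists v; split=> //; exact: (spos_posinv _ pv).1.
split=> //; apply: posinv_spos; split=> //.
have [y [xy yx]] := px.2.
have l1 : csqrt x * (csqrt x * y) = 1 by rewrite mulrA rr.
have r1 : (y * csqrt x) * csqrt x = 1 by rewrite -mulrA rr.
exists (csqrt x * y); split=> //.
suff <- : y * csqrt x = csqrt x * y by [].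
by rewrite -[LHS]mulr1 -l1 mulrA r1 mul1r.
Qed.

Lemma spos_sq x : star x = x -> invertible x -> spos (x * x).
Proof.
move=> sx ix; apply: spos_limit; first by rewrite star_mul sx.
  exact: invertibleM.
by move=> e; exact: spos_sqD.
Qed.

(** For c >= 0, x y x + c = x (y + c x^-1 x^-1) x is a product of invertible
elements. *)
Lemma spos_congruence x y :
  star x = x -> invertible x -> spos y -> spos (x * y * x).
Proof.
move=> sx ix py; have [x' [xx' x'x]] := ix.
have sx' : star x' = x'.
  have h : star x' * x = 1 by rewrite -{1}sx -star_mul xx' star1.
  by rewrite -[LHS]mulr1 -xx' mulrA h mul1r.
have px' : spos (x' * x') by apply: spos_sq => //; exists x.
apply: spos_of_invertibleD => [|c c0]; first by rewrite !star_mul sx py.1 mulrA.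
have -> : x * y * x + sc c = x * (y + sc c * (x' * x')) * x.
  by rewrite mulrDr mulrDl !mulrA scC -!mulrA x'x mulr1 xx' mulr1.
apply: invertibleM => //; apply: invertibleM => //; apply: spos_invertible.
have [->|cn0] := eqVneq c 0; first by rewrite sc0 mul0r addr0.
by apply: sposD => //; apply: sposZ => //; rewrite lt_def cn0.
Qed.

End CStarTheory.

Theorem mainTheorem4 (R : realType) (A : cstarAlgType R) (a b : A)
    (ha : posinv A a) (hb : posinv A b) :
  let m : A := cabs (csqrt b * csqrt a) in
  m = csqrt (csqrt a * b * csqrt a) /\
  [set x : A | x * a * x = b] =
  [set cinv (csqrt a) * m * e * cinv (csqrt a) |
     e in [set e : A | reflections A e /\ e * m = m * e]].
Proof.
move=> m; set s := csqrt a; set t := csqrt b.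
have [ps sE] := csqrtP _ ha; rewrite -/s in ps sE.
have [pt tE] := csqrtP _ hb; rewrite -/t in pt tE.
have mE : m = csqrt (s * b * s).
  by rewrite /m -/s -/t /cabs star_mul ps.1 pt.1 -tE !mulrA.
split=> //.
have si := spos_invertible _ ps.
have pc : spos (s * b * s).
  by apply: spos_congruence => //; [exact: ps.1 | exact: posinv_spos].
have [pm mm] : spos m /\ m * m = s * b * s.
  by rewrite mE; apply: csqrtP; exact: spos_posinv.
have [ss' s's] := cinvP _ si; set s' := cinv s in ss' s's *.
have [mn nm] := cinvP _ (spos_invertible _ pm); set n := cinv m in mn nm *.
clearbody s t m s' n.
apply/seteqP; split=> x /=.
- move=> xax; pose y := s * x * s.
  have yy : y * y = m * m by rewrite /y mm -xax -sE !mulrA.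
  have ym : y * m = m * y.
    by apply: commute_of_commute_sq => //; rewrite -yy mulrA.
  have ny : n * y = y * n.
    by rewrite -[LHS]mulr1 -mn mulrA -(mulrA n) ym mulrA nm mul1r.
  have ee : (n * y) * (n * y) = 1.
    by rewrite {2}ny mulrA -(mulrA n y y) yy mulrA nm mul1r mn.
  exists (n * y).
    split; first by split; [exists (n * y) | rewrite expr2].
    by rewrite mulrA mn mul1r -mulrA ym mulrA nm mul1r.
  rewrite mulrA -(mulrA s') mn mulr1 /y !mulrA s's mul1r.
  by rewrite -mulrA ss' mulr1.
- move=> [e [[_ ee] em] <-]; rewrite expr2 in ee.
  have E : s' * m * e * s' * a * (s' * m * e * s') = s' * (m * e * (m * e)) * s'.
    by rewrite -sE -!mulrA (mulrA s' s) s's mul1r (mulrA s s') ss' mul1r.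
  have mme : m * e * (m * e) = m * m.
    by rewrite -{2}em -(mulrA m e) (mulrA e e) ee mul1r.
  by rewrite E mme mm !mulrA s's mul1r -mulrA ss' mulr1.
Qed.
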